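(* Let $R$ and $S$ be associative rings with identity and let ${}_SP_R$ be an $(S,R)$-bimodule. The following statements are equivalent: (i) ${}_SP_R$ is invertible. (ii) ${}_SP_R$ is projective of rank one.
   Context: Modules are unitary. A bimodule ${}_SP_R$ is invertible if the functor $P\otimes_R-:R\text{-Mod}\to S\text{-Mod}$ (between categories of all left modules) is an equivalence of categories. A bimodule ${}_SP_R$ is faithfully balanced if the natural maps $S\to\mathrm{End}(P_R)$ and $R\to\mathrm{End}({}_SP)$ (given by left, resp. right, multiplication) are isomorphisms. A bimodule ${}_SP_R$ is projective of rank one if it is faithfully balanced and both $P_R$ and ${}_SP$ are finitely generated projective modules. *)

(* Defs.v *)
From HB Require Import structures.
From mathcomp Require Import all_boot all_algebra ring_quotient.
From mathcomp Require Import boolp.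
From mathcomp.multinomials Require Import freeg.

Set Implicit Arguments.
Unset Strict Implicit.
Unset Printing Implicit Defensive.

Import GRing.Theory.
Local Open Scope ring_scope.
Local Open Scope quotient_scope.

Record category := Category {
  obj :> Type;
  hom : obj -> obj -> Type;
  idm : forall X, hom X X;
  compm : forall X Y Z, hom Y Z -> hom X Y -> hom X Z;
  compm1 : forall X Y (f : hom X Y), compm f (idm X) = f;
  comp1m : forall X Y (f : hom X Y), compm (idm Y) f = f;
  compmA : forall X Y Z T (h : hom Z T) (g : hom Y Z) (f : hom X Y),
    compm h (compm g f) = compm (compm h g) f
}.

Record functor (C D : category) := Functor {
  fobj :> C -> D;
  fmap : forall X Y : C, hom X Y -> hom (fobj X) (fobj Y);
  fmap1 : forall X : C, fmap (idm X) = idm (fobj X);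
  fmapM : forall (X Y Z : C) (g : hom Y Z) (f : hom X Y),
    fmap (compm g f) = compm (fmap g) (fmap f)
}.

Definition idF (C : category) : functor C C :=
  @Functor C C id (fun _ _ f => f) (fun _ => erefl) (fun _ _ _ _ _ => erefl).

Section Compose.
Variables (C D E : category) (G : functor D E) (F : functor C D).

Lemma compF1 (X : C) : fmap G (fmap F (idm X)) = idm (G (F X)).
Proof. by rewrite !fmap1. Qed.

Lemma compFM (X Y Z : C) (g : hom Y Z) (f : hom X Y) :
  fmap G (fmap F (compm g f)) =
  compm (fmap G (fmap F g)) (fmap G (fmap F f)).
Proof. by rewrite !fmapM. Qed.

Definition compF : functor C E :=
  @Functor C E (fun X => G (F X)) (fun _ _ f => fmap G (fmap F f)) compF1 compFM.

End Compose.

Definition is_iso (C : category) (X Y : C) (f : hom X Y) : Prop :=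
  exists g : hom Y X, compm g f = idm X /\ compm f g = idm Y.

Definition nat_iso (C D : category) (F G : functor C D) : Prop :=
  exists eta : forall X : C, hom (F X) (G X),
    (forall (X Y : C) (f : hom X Y),
        compm (eta Y) (fmap F f) = compm (fmap G f) (eta X)) /\
    (forall X : C, is_iso (eta X)).

Definition is_equivalence (C D : category) (F : functor C D) : Prop :=
  exists G : functor D C,
    nat_iso (compF G F) (idF C) /\ nat_iso (compF F G) (idF D).

Section Modules.
Variable R : pzRingType.

Lemma linear_ext (U V : lmodType R) (f g : {linear U -> V}) : f =1 g -> f = g.
Proof.
case: f g => [f [[f0] [fZ]]] [g [[g0] [gZ]]] /= /funext e.
by case: _ / e in g0 gZ *; rewrite (Prop_irrelevance f0 g0) (Prop_irrelevance fZ gZ).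
Qed.

Lemma linear_compm1 (U V : lmodType R) (f : {linear U -> V}) :
  (f \o idfun : {linear U -> V}) = f.
Proof. exact: linear_ext. Qed.

Lemma linear_comp1m (U V : lmodType R) (f : {linear U -> V}) :
  (idfun \o f : {linear U -> V}) = f.
Proof. exact: linear_ext. Qed.

Lemma linear_compmA (U V W T : lmodType R)
    (h : {linear W -> T}) (g : {linear V -> W}) (f : {linear U -> V}) :
  (h \o (g \o f : {linear U -> W}) : {linear U -> T}) =
  ((h \o g : {linear V -> T}) \o f : {linear U -> T}).
Proof. exact: linear_ext. Qed.

Definition ModCat : category :=
  @Category (lmodType R) (fun U V => {linear U -> V})
    (fun U => idfun : {linear U -> U})
    (fun U V W g f => g \o f : {linear U -> W})
    linear_compm1 linear_comp1m linear_compmA.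

Definition finitely_generated (M : lmodType R) : Prop :=
  exists (n : nat) (x : 'I_n -> M),
    forall m : M, exists c : 'I_n -> R, m = \sum_(i < n) c i *: x i.

Definition projective (M : lmodType R) : Prop :=
  forall (A B : lmodType R) (g : {linear A -> B}) (f : {linear M -> B}),
    (forall b, exists a, g a = b) -> exists h : {linear M -> A}, g \o h =1 f.

End Modules.

Definition EndRing (R : pzRingType) (M : lmodType R) : Type := {linear M -> M}.

Section EndomorphismRing.
Variables (R : pzRingType) (M : lmodType R).
Local Notation E := (EndRing M).
Implicit Types f g h : E.

HB.instance Definition _ := gen_eqMixin E.
HB.instance Definition _ := gen_choiceMixin E.

Definition end0 : E := \0 : {linear M -> M}.
Definition endN f : E := (\- (f : {linear M -> M})) : {linear M -> M}.
Definition endD f g : E :=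
  ((f : {linear M -> M}) \+ (g : {linear M -> M})) : {linear M -> M}.
Definition end1 : E := idfun : {linear M -> M}.
Definition endM f g : E :=
  ((f : {linear M -> M}) \o (g : {linear M -> M})) : {linear M -> M}.

Lemma endDA : associative endD.
Proof. by move=> f g h; apply: linear_ext => x /=; rewrite addrA. Qed.
Lemma endDC : commutative endD.
Proof. by move=> f g; apply: linear_ext => x /=; rewrite addrC. Qed.
Lemma end0D : left_id end0 endD.
Proof. by move=> f; apply: linear_ext => x /=; rewrite add0r. Qed.
Lemma endND : left_inverse end0 endN endD.
Proof. by move=> f; apply: linear_ext => x /=; rewrite addNr. Qed.
HB.instance Definition _ := GRing.isZmodule.Build E endDA endDC end0D endND.

Lemma endMA : associative endM.
Proof. by move=> f g h; apply: linear_ext. Qed.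
Lemma end1M : left_id end1 endM.
Proof. by move=> f; apply: linear_ext. Qed.
Lemma endM1 : right_id end1 endM.
Proof. by move=> f; apply: linear_ext. Qed.
Lemma endMDl : left_distributive endM endD.
Proof. by move=> f g h; apply: linear_ext. Qed.
Lemma endMDr : right_distributive endM endD.
Proof. by move=> f g h; apply: linear_ext => x /=; rewrite linearD. Qed.
HB.instance Definition _ :=
  GRing.Zmodule_isPzRing.Build E endMA end1M endM1 endMDl endMDr.

End EndomorphismRing.

HB.mixin Record isBimodule (S R : pzRingType) P of GRing.Lmodule S P := {
  rscale : P -> R -> P;
  rscaleA : forall (p : P) (a b : R), rscale (rscale p a) b = rscale p (a * b);
  rscale1 : forall p : P, rscale p 1 = p;
  rscaleDl : forall a : R, {morph rscale^~ a : p q / p + q};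
  rscaleDr : forall p : P, {morph rscale p : a b / a + b};
  scale_rscale : forall (s : S) (p : P) (a : R),
    s *: rscale p a = rscale (s *: p) a
}.

#[short(type="bimodType")]
HB.structure Definition Bimodule (S R : pzRingType) :=
  {P of isBimodule S R P & GRing.Lmodule S P}.

Notation "p *r a" := (rscale p a) (at level 40, left associativity) : ring_scope.

(* A right R-module is a left module over the converse ring R^c; the alias keeps
   this structure apart from the left S-module structure of P. *)
Definition right_module (S R : pzRingType) (P : bimodType S R) : Type := P.

Section RightModule.
Variables (S R : pzRingType) (P : bimodType S R).
Local Notation PR := (right_module P).

HB.instance Definition _ := GRing.Zmodule.on PR.

Definition right_scale (a : R^c) (p : PR) : PR := (p : P) *r (a : R).

Lemma right_scaleA a b p :
  right_scale a (right_scale b p) = right_scale (a * b) p.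
Proof. exact: rscaleA. Qed.
Lemma right_scale1 : left_id 1 right_scale.
Proof. exact: rscale1. Qed.
Lemma right_scaleDr : right_distributive right_scale +%R.
Proof. move=> a; exact: rscaleDl. Qed.
Lemma right_scaleDl p : {morph right_scale^~ p : a b / a + b}.
Proof. exact: (@rscaleDr _ _ P p). Qed.
HB.instance Definition _ := GRing.Zmodule_isLmodule.Build R^c PR
  right_scaleA right_scale1 right_scaleDr right_scaleDl.

End RightModule.

Section NaturalMaps.
Variables (S R : pzRingType) (P : bimodType S R).
Local Notation PR := (right_module P : lmodType R^c).

Definition lmul_fun (s : S) (p : PR) : PR := s *: (p : P).

Lemma lmul_fun_linear s : linear (lmul_fun s).
Proof.
move=> a p q; rewrite /lmul_fun [s *: _]scalerDr; congr (_ + _).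
exact: scale_rscale.
Qed.
HB.instance Definition _ s :=
  GRing.isLinear.Build R^c PR PR _ (lmul_fun s) (lmul_fun_linear s).

Definition lmul (s : S) : EndRing PR := lmul_fun s : {linear PR -> PR}.

Lemma lmul_zmod_morphism : zmod_morphism lmul.
Proof. by move=> s t; apply: linear_ext => p; apply: (@scalerBl S P s t p). Qed.
Lemma lmul_monoid_morphism : monoid_morphism lmul.
Proof.
split=> [|s t]; apply: linear_ext => p; first exact: (@scale1r S P).
exact/esym/(@scalerA S P).
Qed.
HB.instance Definition _ := GRing.isZmodMorphism.Build S (EndRing PR) lmul
  lmul_zmod_morphism.
HB.instance Definition _ := GRing.isMonoidMorphism.Build S (EndRing PR) lmul
  lmul_monoid_morphism.

Definition rmul_fun (a : R) (p : P) : P := p *r a.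

Lemma rmul_fun_linear a : linear (rmul_fun a).
Proof. by move=> s p q; rewrite /rmul_fun rscaleDl scale_rscale. Qed.
HB.instance Definition _ a :=
  GRing.isLinear.Build S P P _ (rmul_fun a) (rmul_fun_linear a).

(* Endomorphisms of the left module act on the side opposite to the scalars,
   hence the converse ring. *)
Definition rmul (a : R) : (EndRing P)^c := rmul_fun a : {linear P -> P}.

Lemma rmul_zmod_morphism : zmod_morphism rmul.
Proof.
move=> a b; apply: linear_ext => p.
exact: (@scalerBl R^c (right_module P) a b p).
Qed.
Lemma rmul_monoid_morphism : monoid_morphism rmul.
Proof.
split=> [|a b]; apply: linear_ext => p; first exact: (@rscale1 S R P).
exact/esym/(@rscaleA S R P).
Qed.
HB.instance Definition _ := GRing.isZmodMorphism.Build R (EndRing P)^c rmul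
  rmul_zmod_morphism.
HB.instance Definition _ := GRing.isMonoidMorphism.Build R (EndRing P)^c rmul
  rmul_monoid_morphism.

End NaturalMaps.

Section Tensor.
Variables (S R : pzRingType) (P : bimodType S R) (M : lmodType R).

Definition free_prod : zmodType := {freeg (P * M)%type / int}.

Definition free_gen (p : P) (m : M) : free_prod := << (p, m) >>.

Inductive tensor_relator : free_prod -> Prop :=
| TensorDl p q m :
    tensor_relator (free_gen (p + q) m - (free_gen p m + free_gen q m))
| TensorDr p m n :
    tensor_relator (free_gen p (m + n) - (free_gen p m + free_gen p n))
| TensorBal p a m :
    tensor_relator (free_gen (p *r a) m - free_gen p (a *: m)).

(* The subgroup generated by the relators. *)
Definition tensor_null : pred free_prod := fun x =>
  `[< forall Z : {pred free_prod}, zmod_closed Z ->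
      (forall y, tensor_relator y -> y \in Z) -> x \in Z >].

Lemma tensor_null_closed : zmod_closed tensor_null.
Proof.
split=> [|x y /asboolP Nx /asboolP Ny]; apply/asboolP => Z Zc Zr.
  by case: Zc.
by case: (Zc) => _; apply; [apply: Nx | apply: Ny].
Qed.
HB.instance Definition _ :=
  GRing.isZmodClosed.Build free_prod tensor_null tensor_null_closed.

Definition tensor_subgroup : zmodClosed free_prod :=
  GRing.ZmodClosed.clone _ tensor_null _.

Local Notation quot := (Quotient.quot tensor_subgroup).

Definition tensor : Type := quot.
HB.instance Definition _ := GRing.Zmodule.on tensor.

Definition tens (p : P) (m : M) : tensor :=
  \pi_quot (free_gen p m).

Lemma tensor_relatorW x : tensor_relator x -> x \in tensor_null.
Proof. by move=> rx; apply/asboolP => Z _; apply. Qed.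

Lemma tensorBE x y : x - y \in tensor_null ->
  \pi_quot x = \pi_quot y.
Proof. by rewrite Quotient.idealrBE => /eqP. Qed.

Lemma tensDl p q m : tens (p + q) m = tens p m + tens q m.
Proof.
rewrite [RHS](esym (raddfD \pi_quot _ _)).
exact/tensorBE/tensor_relatorW/TensorDl.
Qed.

Lemma tensDr p m n : tens p (m + n) = tens p m + tens p n.
Proof.
rewrite [RHS](esym (raddfD \pi_quot _ _)).
exact/tensorBE/tensor_relatorW/TensorDr.
Qed.

Lemma tens_bal p a m : tens (p *r a) m = tens p (a *: m).
Proof. exact/tensorBE/tensor_relatorW/TensorBal. Qed.

Definition balanced (A : zmodType) (b : P -> M -> A) : Prop :=
  [/\ forall m, {morph b^~ m : p q / p + q},
      forall p, {morph b p : m n / m + n} &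
      forall p a m, b (p *r a) m = b p (a *: m)].

Definition free_lift (A : zmodType) (b : P -> M -> A) (x : free_prod) : A :=
  fglift (fun pm => b pm.1 pm.2 : zmodule A) x.

Lemma free_lift_zmod_morphism A b : zmod_morphism (@free_lift A b).
Proof. exact: (@lift_is_additive int _ (zmodule A)). Qed.
HB.instance Definition _ A b := GRing.isZmodMorphism.Build free_prod A
  (@free_lift A b) (free_lift_zmod_morphism b).

Lemma free_liftE (A : zmodType) b p m :
  @free_lift A b (free_gen p m) = b p m.
Proof. by rewrite /free_lift /free_gen liftU scale1r. Qed.

Lemma free_lift_null (A : zmodType) (b : P -> M -> A) x :
  balanced b -> x \in tensor_null -> free_lift b x = 0.
Proof.
case=> bl br bb /asboolP/(_ [pred y | free_lift b y == 0]) /=.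
move=> h; apply/eqP; apply: h.
  split=> [|y z /eqP ey /eqP ez]; apply/eqP; first exact: raddf0.
  by rewrite raddfB /= ey ez subrr.
move=> _ [p q m|p m n|p a m]; apply/eqP; rewrite raddfB ?raddfD /= !free_liftE.
- by rewrite bl -opprD subrr.
- by rewrite br -opprD subrr.
- by rewrite bb subrr.
Qed.

(* Meaningful only for balanced b: see tens_liftE and tens_lift_additive. *)
Definition tens_lift (A : zmodType) (b : P -> M -> A) (t : tensor) : A :=
  free_lift b (repr (t : quot)).

Lemma tens_lift_pi (A : zmodType) (b : P -> M -> A) x : balanced b ->
  tens_lift b (\pi_quot x) = free_lift b x.
Proof.
move=> bb; apply/eqP; rewrite -subr_eq0 -raddfB; apply/eqP.
apply: free_lift_null => //; rewrite Quotient.idealrBE.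
by rewrite reprK.
Qed.

Lemma tens_liftE (A : zmodType) (b : P -> M -> A) p m : balanced b ->
  tens_lift b (tens p m) = b p m.
Proof. by move=> bb; rewrite tens_lift_pi // free_liftE. Qed.

Lemma tens_lift_additive (A : zmodType) (b : P -> M -> A) : balanced b ->
  {morph tens_lift b : t u / t + u}.
Proof.
move=> bb t u.
rewrite -[t](@reprK _ quot).
rewrite -[u](@reprK _ quot).
rewrite [_ + _](esym (raddfD \pi_quot _ _)).
by rewrite !tens_lift_pi // raddfD.
Qed.

Lemma tensor_ext (A : zmodType) (f g : tensor -> A) :
  {morph f : t u / t + u} -> {morph g : t u / t + u} ->
  (forall p m, f (tens p m) = g (tens p m)) -> f =1 g.
Proof.
move=> fD gD fg t.
have f0 : f 0 = 0 by apply: (addrI (f 0)); rewrite -fD !addr0.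
have g0 : g 0 = 0 by apply: (addrI (g 0)); rewrite -gD !addr0.
have fN u : f (- u) = - f u.
  by apply: (addrI (f u)); rewrite -fD !subrr.
have gN u : g (- u) = - g u.
  by apply: (addrI (g u)); rewrite -gD !subrr.
rewrite -[t](@reprK _ quot).
rewrite -[repr _]freeg_sumE.
rewrite (raddf_sum \pi_quot) /=.
rewrite (big_morph f fD f0) (big_morph g gD g0).
apply: eq_bigr => -[p m] _; set c := coeff _ _.
have -> : << c *g (p, m) >> = free_gen p m *~ c.
  by rewrite /free_gen freegU_mulz intz.
have fn u n : f (u *+ n) = f u *+ n.
  by elim: n => [|n IH]; rewrite ?mulr0n // !mulrS fD IH.
have gn u n : g (u *+ n) = g u *+ n.
  by elim: n => [|n IH]; rewrite ?mulr0n // !mulrS gD IH.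
have fz u z : f (u *~ z) = f u *~ z.
  by case: z => n; rewrite ?NegzE ?mulrNz -!pmulrn ?fN fn.
have gz u z : g (u *~ z) = g u *~ z.
  by case: z => n; rewrite ?NegzE ?mulrNz -!pmulrn ?gN gn.
rewrite (raddfMz \pi_quot).
by rewrite fz gz; congr (_ *~ _); apply: fg.
Qed.

Definition tens_scale (s : S) : tensor -> tensor :=
  tens_lift (fun p m => tens (s *: p) m).

Lemma tens_scale_balanced s : balanced (fun p m => tens (s *: p) m).
Proof.
split=> [m p q|p m n|p a m]; first by rewrite scalerDr tensDl.
- by rewrite tensDr.
- by rewrite scale_rscale tens_bal.
Qed.

Lemma tens_scaleE s p m : tens_scale s (tens p m) = tens (s *: p) m.
Proof. exact/tens_liftE/tens_scale_balanced. Qed.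

Lemma tens_scaleDr : right_distributive tens_scale +%R.
Proof. move=> s; exact/tens_lift_additive/tens_scale_balanced. Qed.

Lemma tens_scaleA s t x : tens_scale s (tens_scale t x) = tens_scale (s * t) x.
Proof.
apply: (tensor_ext (f := tens_scale s \o tens_scale t)) x => [x y|x y|p m] /=.
- by rewrite !tens_scaleDr.
- exact: tens_scaleDr.
- by rewrite !tens_scaleE scalerA.
Qed.

Lemma tens_scale1 : left_id 1 tens_scale.
Proof.
apply: (tensor_ext (g := id)) => [x y|x y|p m] //=; first exact: tens_scaleDr.
by rewrite tens_scaleE scale1r.
Qed.

Lemma tens_scaleDl x : {morph tens_scale^~ x : s t / s + t}.
Proof.
move=> s t; move: x.
apply: (tensor_ext (g := fun x => tens_scale s x + tens_scale t x)).
- exact: tens_scaleDr.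
- by move=> x y; rewrite !tens_scaleDr addrACA.
- by move=> p m; rewrite !tens_scaleE scalerDl tensDl.
Qed.
HB.instance Definition _ := GRing.Zmodule_isLmodule.Build S tensor
  tens_scaleA tens_scale1 tens_scaleDr tens_scaleDl.

End Tensor.

Section TensorFunctor.
Variables (S R : pzRingType) (P : bimodType S R).

Section Map.
Variables (M N : lmodType R) (f : {linear M -> N}).

Definition tens_map_fun : tensor P M -> tensor P N :=
  tens_lift (fun p m => tens p (f m)).

Lemma tens_map_balanced : balanced (fun p m => tens p (f m) : tensor P N).
Proof.
split=> [m p q|p m n|p a m]; first by rewrite tensDl.
- by rewrite linearD tensDr.
- by rewrite linearZ tens_bal.
Qed.

Lemma tens_map_funE p m : tens_map_fun (tens p m) = tens p (f m).
Proof. exact/tens_liftE/tens_map_balanced. Qed.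

Lemma tens_map_funD : {morph tens_map_fun : t u / t + u}.
Proof. exact/tens_lift_additive/tens_map_balanced. Qed.

Lemma tens_map_fun_linear : linear tens_map_fun.
Proof.
move=> s t u; rewrite tens_map_funD; congr (_ + _); move: t {u}.
apply: (tensor_ext (f := tens_map_fun \o *:%R s)
                   (g := *:%R s \o tens_map_fun)).
- by move=> t u /=; rewrite scalerDr tens_map_funD.
- by move=> t u /=; rewrite tens_map_funD scalerDr.
- by move=> p m /=; rewrite [s *: _]tens_scaleE !tens_map_funE [RHS]tens_scaleE.
Qed.
HB.instance Definition _ := GRing.isLinear.Build S (tensor P M) (tensor P N) _
  tens_map_fun tens_map_fun_linear.

Definition tens_map : {linear tensor P M -> tensor P N} := tens_map_fun.

Lemma tens_mapE p m : tens_map (tens p m) = tens p (f m).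
Proof. exact: tens_map_funE. Qed.

End Map.

Lemma tens_map1 (M : lmodType R) :
  tens_map (idfun : {linear M -> M}) = (idfun : {linear tensor P M -> _}).
Proof.
apply/linear_ext/tensor_ext => [t u|t u|p m] //; first exact: linearD.
by rewrite tens_mapE.
Qed.

Lemma tens_mapM (M N L : lmodType R) (g : {linear N -> L}) (f : {linear M -> N}) :
  tens_map (g \o f : {linear M -> L}) =
  (tens_map g \o tens_map f : {linear tensor P M -> tensor P L}).
Proof.
apply/linear_ext/tensor_ext => [t u|t u|p m]; try exact: linearD.
by rewrite /= !tens_mapE.
Qed.

Definition tensor_functor : functor (ModCat R) (ModCat S) :=
  @Functor (ModCat R) (ModCat S) (fun M => tensor P M : lmodType S) tens_map
    tens_map1 tens_mapM.

End TensorFunctor.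

Definition invertible (S R : pzRingType) (P : bimodType S R) : Prop :=
  is_equivalence (tensor_functor P).

(* lmul and rmul are ring morphisms by the instances above, so bijectivity is
   what being a ring isomorphism adds. *)
Definition faithfully_balanced (S R : pzRingType) (P : bimodType S R) : Prop :=
  bijective (@lmul S R P) /\ bijective (@rmul S R P).

Definition projective_rank_one (S R : pzRingType) (P : bimodType S R) : Prop :=
  [/\ faithfully_balanced P,
      finitely_generated (right_module P : lmodType R^c) /\
      projective (right_module P : lmodType R^c) &
      finitely_generated (P : lmodType S) /\ projective (P : lmodType S)].

(* Main.v *)
From HB Require Import structures.
From mathcomp Require Import all_boot all_algebra boolp.
From mathcomp.multinomials Require Import freeg.
Require Import Defs.

Set Implicit Arguments.
Unset Strict Implicit.
Unset Printing Implicit Defensive.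

(** Let Q = Hom_S(P, S). Both conditions amount to a Morita context with onto
    pairings: evaluation alpha : P x Q -> S and a map beta : Q x P -> R with
    alpha(p, q) p' = p beta(q, p') and beta(q, p) q' = q alpha(p, q'). The
    pairing beta exists as soon as R = End(_S P).
    Given the context, write 1 = sum_i beta(q_i, p_i). The contraction
    q (x) (p (x) m) |-> beta(q, p) m from Q (x) (P (x) M) to M is inverted by
    m |-> sum_i q_i (x) (p_i (x) m), and by symmetry P (x) (Q (x) N) = N, so
    tensoring with Q is inverse to tensoring with P. The same expressions of 1
    are dual bases of P on either side and give back R and S as endomorphism
    rings of P.
    If P is projective of rank one, dual bases of P on either side, read through
    the faithful balance, express 1 by values of alpha and of beta.
    If P is invertible, full faithfulness at R gives R = End(_S P), and the
    preimage of 1 under an isomorphism P (x) M = S shows that alpha is onto.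
    Then P (x) (Q (x) P) = P = P (x) R by contraction; fullness turns the
    inverse of this isomorphism into a section of beta : Q (x) P -> R, so beta
    is onto. *)

Import GRing.Theory.
Local Open Scope ring_scope.
Local Open Scope quotient_scope.

Section Functors.
Variables C D : category.

Definition faithful (F : functor C D) : Prop :=
  forall X Y : C, injective (@fmap C D F X Y).

Definition full (F : functor C D) : Prop :=
  forall (X Y : C) (h : hom (F X) (F Y)), exists f : hom X Y, fmap F f = h.

Definition essentially_surjective (F : functor C D) : Prop :=
  forall Y : D, exists (X : C) (f : hom (F X) Y), is_iso f.

Lemma nat_iso_faithful (F G : functor C D) :
  nat_iso F G -> faithful G -> faithful F.
Proof.
case=> eta [nat_eta iso_eta] faithG X Y f g eqFfg.
have [u [_ eta_u]] := iso_eta X.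
apply: faithG; rewrite -[fmap G f]compm1 -[fmap G g]compm1 -eta_u !compmA.
by rewrite -!nat_eta eqFfg.
Qed.

End Functors.

Lemma comp_faithful (C D E : category) (G : functor D E) (F : functor C D) :
  faithful (compF G F) -> faithful F.
Proof. by move=> faithGF X Y f g eqFfg; apply: faithGF; rewrite /= eqFfg. Qed.

Lemma nat_iso_id_faithful (C : category) (F : functor C C) :
  nat_iso F (idF C) -> faithful F.
Proof. by move/nat_iso_faithful; apply=> X Y f g. Qed.

Section EquivalenceProperties.
Variables (C D : category) (F : functor C D).
Hypothesis equivF : is_equivalence F.

Lemma equivalence_faithful : faithful F.
Proof.
case: equivF => G [/nat_iso_id_faithful faithGF _].
exact: comp_faithful faithGF.
Qed.

Lemma equivalence_full : full F.
Proof.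
case: equivF => G [[eta [nat_eta iso_eta]] /nat_iso_id_faithful faithFG] X Y h.
have [u [u_eta _]] := iso_eta X; have [v [v_eta _]] := iso_eta Y.
exists (compm (eta Y) (compm (fmap G h) u)).
apply: (comp_faithful faithFG); set f := compm _ _.
rewrite -[LHS]comp1m -v_eta -compmA (nat_eta _ _ f) /= /f -!compmA u_eta.
by rewrite compm1 compmA v_eta comp1m.
Qed.

Lemma equivalence_essentially_surjective : essentially_surjective F.
Proof.
case: equivF => G [_ [eta [_ iso_eta]]] Y.
by exists (G Y), (eta Y); apply: iso_eta.
Qed.

End EquivalenceProperties.

Definition linear_of (R : pzRingType) (U V : lmodType R) (f : U -> V)
    (lf : linear f) : {linear U -> V} :=
  HB.pack f (GRing.isLinear.Build R U V _ f lf).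

Lemma bijective_is_iso (R : pzRingType) (U V : lmodType R)
    (f : {linear U -> V}) : bijective f -> @is_iso (ModCat R) U V f.
Proof.
case=> g fK gK; exists (linear_of (can2_linear fK gK)).
by split; apply: linear_ext.
Qed.

Section DualBasis.
Variables (R : pzRingType) (M : lmodType R).

Definition dual_basis (s : seq ({linear M -> R^o} * M)) : Prop :=
  forall m, m = \sum_(x <- s) (x.1 m : R) *: x.2.

Lemma dual_basis_finitely_generated s : dual_basis s -> finitely_generated M.
Proof.
move=> dbs; exists (size s), (fun i => (tnth (in_tuple s) i).2) => m.
exists (fun i => (tnth (in_tuple s) i).1 m).
by rewrite {1}[m]dbs big_tnth.
Qed.

Lemma dual_basis_projective s : dual_basis s -> projective M.
Proof.
move=> dbs A B g f /choice[k gk].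
pose h m := \sum_(x <- s) (x.1 m : R) *: k (f x.2).
have h_linear : linear h.
  move=> a m n; rewrite /h scaler_sumr -big_split /=; apply: eq_bigr => x _.
  by rewrite linearP scalerDl scalerA.
exists (linear_of h_linear) => m /=; rewrite {2}[m]dbs /h !linear_sum.
by apply: eq_bigr => x _; rewrite !linearZ /= gk.
Qed.

Lemma projective_dual_basis :
  finitely_generated M -> projective M -> exists s, dual_basis s.
Proof.
move=> [n [x gen_x]] projM.
pose comb (c : 'rV[R]_n) := \sum_(i < n) c 0 i *: x i.
have comb_linear : linear comb.
  move=> a c d; rewrite /comb scaler_sumr -big_split /=; apply: eq_bigr => i _.
  by rewrite !mxE scalerDl scalerA.
have comb_onto m : exists c, linear_of comb_linear c = m.
  have [c ->] := gen_x m; exists (\row_i c i); apply: eq_bigr => i _.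
  by rewrite mxE.
have [h combK] := projM _ _ _ (idfun : {linear M -> M}) comb_onto.
have coord_linear i : linear (fun m => h m 0 i : R^o).
  by move=> a m n'; rewrite linearP !mxE.
exists [seq (linear_of (coord_linear i), x i) | i <- enum 'I_n] => m.
by rewrite big_map big_enum -{1}[m]combK.
Qed.

End DualBasis.

Section Tensor.
Variables (S R : pzRingType) (P : bimodType S R) (M : lmodType R).

Lemma tensor_linear_ext (N : lmodType S) (f g : {linear tensor P M -> N}) :
  (forall p m, f (tens p m) = g (tens p m)) -> f =1 g.
Proof. by move=> fg; apply: tensor_ext => //; apply: linearD. Qed.

Lemma tens_lift_linear (N : lmodType S) (b : P -> M -> N) :
  balanced b -> (forall s p m, b (s *: p) m = s *: b p m) ->
  linear (tens_lift b).
Proof.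
move=> bb bZ s t u; rewrite tens_lift_additive //; congr (_ + _); move: t {u}.
apply: (tensor_ext (f := tens_lift b \o *:%R s) (g := *:%R s \o tens_lift b)).
- by move=> t u /=; rewrite scalerDr tens_lift_additive.
- by move=> t u /=; rewrite tens_lift_additive // scalerDr.
- by move=> p m /=; rewrite [s *: _]tens_scaleE !tens_liftE.
Qed.

Lemma tens_linearl (m : M) : linear (fun p : P => tens p m).
Proof. by move=> s p q; rewrite tensDl -tens_scaleE. Qed.

Lemma tens_suml (I : Type) (r : seq I) (p : I -> P) (m : M) :
  tens (\sum_(i <- r) p i) m = \sum_(i <- r) tens (p i) m.
Proof. exact: (linear_sum (linear_of (tens_linearl m))). Qed.

Lemma tens_mulz (p : P) (m : M) (z : int) : tens (p *~ z) m = tens p m *~ z.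
Proof. exact: (raddfMz (linear_of (tens_linearl m))). Qed.

Lemma tensor_sum (t : tensor P M) :
  exists s : seq (P * M), t = \sum_(x <- s) tens x.1 x.2.
Proof.
rewrite -[t](@reprK _ (Quotient.quot (tensor_subgroup P M))).
move: (repr _) => D; exists [seq (z.1 *~ coeff z D, z.2) | z <- dom D].
rewrite big_map -{1}[D]freeg_sumE (raddf_sum \pi_(Quotient.quot _)) /=.
apply: eq_bigr => -[p m] _ /=; rewrite tens_mulz; set c := coeff _ _.
have -> : << c *g (p, m) >> = free_gen p m *~ c.
  by rewrite /free_gen freegU_mulz intz.
exact: (raddfMz \pi_(Quotient.quot _)).
Qed.

End Tensor.

Lemma rscale_sumr (S R : pzRingType) (P : bimodType S R) (I : Type)
    (r : seq I) (p : P) (a : I -> R) :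
  p *r (\sum_(i <- r) a i) = \sum_(i <- r) p *r a i.
Proof.
exact: (scaler_suml (p : right_module P) r predT (a : I -> R^c)).
Qed.

Section Unitor.
Variables (S R : pzRingType) (P : bimodType S R).

Lemma rscale_balanced : balanced (fun (p : P) (a : R^o) => p *r a).
Proof.
split=> [a p q|p a b|p a b]; [exact: rscaleDl | exact: rscaleDr |].
exact: rscaleA.
Qed.

Definition unitor : tensor P R^o -> P :=
  tens_lift (fun (p : P) (a : R^o) => p *r a).

Lemma unitor_linear : linear unitor.
Proof.
apply: tens_lift_linear; first exact: rscale_balanced.
by move=> s p a; rewrite scale_rscale.
Qed.
HB.instance Definition _ :=
  GRing.isLinear.Build S (tensor P R^o) P _ unitor unitor_linear.

Definition unitor_inv (p : P) : tensor P R^o := tens p (1 : R^o).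

HB.instance Definition _ := GRing.isLinear.Build S P (tensor P R^o) _ unitor_inv
  (@tens_linearl S R P R^o 1).

Lemma unitorE (p : P) (a : R^o) : unitor (tens p a) = p *r a.
Proof. exact/tens_liftE/rscale_balanced. Qed.

Lemma unitor_invK : cancel unitor_inv unitor.
Proof. by move=> p; rewrite unitorE rscale1. Qed.

Lemma unitorK : cancel unitor unitor_inv.
Proof.
apply: (tensor_linear_ext (f := unitor_inv \o unitor) (g := idfun)) => p a.
by rewrite /= unitorE /unitor_inv tens_bal [a *: _]mulr1.
Qed.

Lemma unitor_tens_map (f : {linear R^o -> R^o}) (t : tensor P R^o) :
  unitor (tens_map P f t) = unitor t *r f 1.
Proof.
move: t; apply: (tensor_linear_ext (f := unitor \o tens_map P f)
                                  (g := rmul_fun (f 1 : R) \o unitor)) => p a.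
by rewrite /= tens_mapE !unitorE /rmul_fun rscaleA -[a in LHS]mulr1 linearZ_LR.
Qed.

Lemma regular_mulr_linear (a : R) : linear (fun b : R^o => b * a : R^o).
Proof. by move=> c x y; rewrite mulrDl -[_ *: _]/(_ * _) -mulrA. Qed.

Lemma faithful_rmul_inj :
  faithful (tensor_functor P) -> injective (@rmul S R P).
Proof.
pose mulr_by a : {linear R^o -> R^o} := linear_of (regular_mulr_linear a).
move=> faithP a b eq_ab; suff eq_mulr : mulr_by a = mulr_by b.
  have := congr1 (fun f : {linear R^o -> R^o} => f 1) eq_mulr.
  by rewrite /= !mul1r.
apply: faithP; apply: linear_ext => t; apply: (can_inj unitorK).
rewrite !unitor_tens_map /= !mul1r.
exact: (congr1 (fun f : EndRing P => f (unitor t)) eq_ab).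
Qed.

Lemma full_rmul_surj (h : EndRing P) :
  full (tensor_functor P) -> exists a : R, rmul P a = h.
Proof.
pose h_unitor : {linear tensor P R^o -> P} := (h : {linear P -> P}) \o unitor.
move=> /(_ R^o R^o
  (unitor_inv \o h_unitor : {linear tensor P R^o -> tensor P R^o})) [f fmapE].
exists (f 1); apply: linear_ext => p.
have := congr1 (fun k : {linear tensor P R^o -> tensor P R^o} =>
  unitor (k (unitor_inv p))) fmapE.
by rewrite [LHS]unitor_tens_map /= !unitor_invK.
Qed.

Lemma full_faithful_rmul_bijective :
  full (tensor_functor P) -> faithful (tensor_functor P) ->
  bijective (@rmul S R P).
Proof.
move=> fullP faithP.
have /choice[g rmulK] (h : EndRing P) := full_rmul_surj h fullP.
by exists g => // a; apply: faithful_rmul_inj.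
Qed.

End Unitor.
Arguments unitor {S R P}.
Arguments unitorK {S R P}.

Section BilinearPairing.
Variables (S R : pzRingType) (P : bimodType S R) (Q : bimodType R S).
Implicit Types alpha : P -> Q -> S.

Record bilinear_pairing alpha : Prop := BilinearPairing {
  pairing_balanced : balanced alpha;
  pairingZl : forall s p q, alpha (s *: p) q = s * alpha p q;
  pairingZr : forall s p q, alpha p (q *r s) = alpha p q * s
}.

(* The values of a bilinear pairing span a two-sided ideal, so reaching 1 means
   that the induced map on the tensor product is onto. *)
Definition onto_pairing alpha : Prop :=
  exists r : seq (P * Q), \sum_(x <- r) alpha x.1 x.2 = 1.

Lemma pairing_linearl alpha q :
  bilinear_pairing alpha -> linear (fun p => alpha p q : S^o).
Proof.
by case=> -[alphaDl _ _] alphaZl _ s p p'; rewrite alphaDl alphaZl.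
Qed.

Lemma pairing_linearr alpha p :
  bilinear_pairing alpha -> linear (alpha p : right_module Q -> (S^c)^o).
Proof.
case=> -[_ alphaDr _] _ alphaZr s q q'.
by rewrite alphaDr [_ *: _ in LHS]/(_ *r _) alphaZr.
Qed.

End BilinearPairing.

Record morita_context (S R : pzRingType) (P : bimodType S R)
    (Q : bimodType R S) (alpha : P -> Q -> S) (beta : Q -> P -> R) : Prop :=
  MoritaContext {
    morita_bilinearl : bilinear_pairing alpha;
    morita_bilinearr : bilinear_pairing beta;
    moritaPQP : forall p q p', alpha p q *: p' = p *r beta q p';
    moritaQPQ : forall q p q', beta q p *: q' = q *r alpha p q'
  }.

Lemma morita_context_sym (S R : pzRingType) (P : bimodType S R)
    (Q : bimodType R S) (alpha : P -> Q -> S) (beta : Q -> P -> R) :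
  morita_context alpha beta -> morita_context beta alpha.
Proof. by case=> pair_alpha pair_beta PQP QPQ; split. Qed.

Section Contraction.
Variables (S R : pzRingType) (P : bimodType S R) (Q : bimodType R S).
Variables (alpha : P -> Q -> S) (beta : Q -> P -> R).
Hypothesis mc : morita_context alpha beta.
Variable M : lmodType R.

Definition pairing_act (q : Q) : tensor P M -> M :=
  tens_lift (fun p m => beta q p *: m).

Lemma pairing_scale_balanced q :
  balanced (fun (p : P) (m : M) => beta q p *: m).
Proof.
have [_ betaDr _] := pairing_balanced (morita_bilinearr mc).
split=> [m p p'|p m n|p a m]; first by rewrite betaDr scalerDl.
  by rewrite scalerDr.
by rewrite (pairingZr (morita_bilinearr mc)) scalerA.
Qed.

Lemma pairing_actE q p m : pairing_act q (tens p m) = beta q p *: m.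
Proof. exact/tens_liftE/pairing_scale_balanced. Qed.

Lemma pairing_actDr q : {morph pairing_act q : t u / t + u}.
Proof. exact/tens_lift_additive/pairing_scale_balanced. Qed.

Lemma pairing_act_balanced : balanced pairing_act.
Proof.
have [betaDl _ beta_bal] := pairing_balanced (morita_bilinearr mc).
split=> [t q q'|q|q s t].
- move: t.
  apply: (tensor_ext (g := fun t => pairing_act q t + pairing_act q' t)).
  + exact: pairing_actDr.
  + by move=> t u; rewrite !pairing_actDr addrACA.
  + by move=> p m; rewrite !pairing_actE betaDl scalerDl.
- exact: pairing_actDr.
- move: t; apply: (tensor_ext (g := pairing_act q \o *:%R s)).
  + exact: pairing_actDr.
  + by move=> t u /=; rewrite scalerDr pairing_actDr.
  + by move=> p m /=; rewrite [s *: _]tens_scaleE !pairing_actE beta_bal.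
Qed.

Lemma pairing_actZ a q t : pairing_act (a *: q) t = a *: pairing_act q t.
Proof.
have betaZ := pairingZl (morita_bilinearr mc).
move: t; apply: (tensor_ext (g := *:%R a \o pairing_act q)).
- exact: pairing_actDr.
- by move=> t u /=; rewrite pairing_actDr scalerDr.
- by move=> p m /=; rewrite !pairing_actE betaZ scalerA.
Qed.

Definition contraction : {linear tensor Q (tensor P M) -> M} :=
  linear_of (tens_lift_linear pairing_act_balanced pairing_actZ).

Lemma contractionE q t : contraction (tens q t) = pairing_act q t.
Proof. exact/tens_liftE/pairing_act_balanced. Qed.

Lemma tens_tens_pairing q p q' p' m :
  tens q' (tens p' (beta q p *: m)) = tens (beta q' p' *: q) (tens p m)
    :> tensor Q (tensor P M).
Proof.
by rewrite -tens_bal -(moritaPQP mc) -tens_scaleE -tens_bal -(moritaQPQ mc).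
Qed.

Lemma contraction_bijective : onto_pairing beta -> bijective contraction.
Proof.
case=> r beta1; pose inv (m : M) := \sum_(x <- r) tens x.1 (tens x.2 m).
have invD : {morph inv : m n / m + n}.
  by move=> m n; rewrite -big_split; apply: eq_bigr => x _; rewrite !tensDr.
exists inv => [|m]; last first.
  rewrite linear_sum; under eq_bigr do rewrite contractionE pairing_actE.
  by rewrite -scaler_suml beta1 scale1r.
apply: (tensor_ext (f := fun t => inv (contraction t)) (g := id)) => //.
  by move=> t u; rewrite linearD invD.
move=> q; apply: (tensor_ext (f := fun t => inv (contraction (tens q t)))).
- by move=> t u; rewrite tensDr linearD invD.
- by move=> t u; rewrite tensDr.
move=> p m; rewrite contractionE pairing_actE /inv.
under eq_bigr do rewrite tens_tens_pairing.
by rewrite -tens_suml -scaler_suml beta1 scale1r.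
Qed.

End Contraction.

Section TensorEquivalence.
Variables (S R : pzRingType) (P : bimodType S R) (Q : bimodType R S).
Variables (alpha : P -> Q -> S) (beta : Q -> P -> R).
Hypothesis mc : morita_context alpha beta.

Lemma pairing_act_tens_map (M N : lmodType R) (f : {linear M -> N}) q
    (t : tensor P M) :
  pairing_act beta q (tens_map P f t) = f (pairing_act beta q t).
Proof.
move: t; apply: (tensor_ext (f := pairing_act beta q \o tens_map P f)
                            (g := f \o pairing_act beta q)) => [t u|t u|p m] /=.
- by rewrite tens_map_funD (pairing_actDr mc).
- by rewrite (pairing_actDr mc) linearD.
by rewrite tens_map_funE !(pairing_actE mc) linearZ.
Qed.

Lemma contraction_nat_iso : onto_pairing beta ->
  nat_iso (compF (tensor_functor Q) (tensor_functor P)) (idF (ModCat R)).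
Proof.
move=> onto_beta; exists (contraction mc); split=> [M N f|M]; last first.
  exact/bijective_is_iso/contraction_bijective.
apply: linear_ext; apply: tensor_linear_ext => q t.
rewrite -[LHS]/(contraction mc N (tens_map Q (tens_map P f) (tens q t))).
by rewrite tens_mapE contractionE pairing_act_tens_map -(contractionE mc).
Qed.

Lemma pairing_lift_linear : linear (tens_lift beta : tensor Q P -> R^o).
Proof.
have [beta_balanced betaZ _] := morita_bilinearr mc.
exact: (tens_lift_linear (N := R^o) beta_balanced betaZ).
Qed.

Definition pairing_lift : {linear tensor Q P -> R^o} :=
  linear_of pairing_lift_linear.

Lemma pairing_liftE q p : pairing_lift (tens q p) = beta q p.
Proof. exact/tens_liftE/(pairing_balanced (morita_bilinearr mc)). Qed.

Lemma unitor_pairing_lift (t : tensor P (tensor Q P)) :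
  unitor (tens_map P pairing_lift t) = contraction (morita_context_sym mc) P t.
Proof.
move: t; apply: (tensor_linear_ext (f := unitor \o tens_map P pairing_lift)).
move=> p t; rewrite /= tens_map_funE unitorE.
rewrite [RHS](contractionE (morita_context_sym mc)).
move: t; apply: (tensor_ext (f := fun t => p *r pairing_lift t)).
- by move=> t u; rewrite linearD rscaleDr.
- by move=> t u; rewrite (pairing_actDr (morita_context_sym mc)).
move=> q p'.
by rewrite pairing_liftE (pairing_actE (morita_context_sym mc)) (moritaPQP mc).
Qed.

Lemma full_faithful_onto_pairing :
  full (tensor_functor P) -> faithful (tensor_functor P) ->
  onto_pairing alpha -> onto_pairing beta.
Proof.
move=> fullP faithP onto_alpha.
have [inv contrK invK] :=
  contraction_bijective (morita_context_sym mc) P onto_alpha.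
pose inv_linear := linear_of (can2_linear contrK invK).
have [f fmapE] := fullP R^o (tensor Q P)
  (inv_linear \o unitor : {linear tensor P R^o -> tensor P (tensor Q P)}).
have liftK : (pairing_lift \o f : {linear R^o -> R^o}) = idfun.
  apply: faithP; apply: linear_ext => t; apply: (can_inj unitorK).
  by rewrite fmapM fmap1 fmapE [LHS]unitor_pairing_lift [LHS]invK.
have [r def_f1] := tensor_sum (f 1); exists r.
have <- : pairing_lift (f 1) = 1.
  exact: (congr1 (fun g : {linear R^o -> R^o} => g 1) liftK).
by rewrite def_f1 linear_sum; apply: eq_bigr => x _; rewrite pairing_liftE.
Qed.

End TensorEquivalence.

Lemma morita_invertible (S R : pzRingType) (P : bimodType S R)
    (Q : bimodType R S) (alpha : P -> Q -> S) (beta : Q -> P -> R) :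
  morita_context alpha beta -> onto_pairing alpha -> onto_pairing beta ->
  invertible P.
Proof.
move=> mc onto_alpha onto_beta; exists (tensor_functor Q); split.
  exact: contraction_nat_iso mc onto_beta.
exact: contraction_nat_iso (morita_context_sym mc) onto_alpha.
Qed.

Section RankOne.
Variables (S R : pzRingType) (P : bimodType S R) (Q : bimodType R S).
Variables (alpha : P -> Q -> S) (beta : Q -> P -> R).
Hypothesis mc : morita_context alpha beta.
Local Notation PR := (right_module P : lmodType R^c).

Section RightDualBasis.
Variable r : seq (P * Q).
Hypothesis sum_alpha : \sum_(x <- r) alpha x.1 x.2 = 1.

Lemma morita_right_dual_basis :
  dual_basis [seq (linear_of (pairing_linearr x.2 (morita_bilinearr mc)),
                   x.1 : PR) | x <- r].
Proof.
move=> p; rewrite big_map /= -{1}[p](@scale1r S P) -sum_alpha scaler_suml.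
by apply: eq_bigr => x _; rewrite (moritaPQP mc).
Qed.

Lemma morita_lmul_bijective : bijective (@lmul S R P).
Proof.
exists (fun h : EndRing PR => \sum_(x <- r) alpha (h x.1) x.2) => [s|h].
  under eq_bigr do rewrite /= /lmul_fun (pairingZl (morita_bilinearl mc)).
  by rewrite -mulr_sumr sum_alpha mulr1.
apply: linear_ext => p; rewrite /= /lmul_fun scaler_suml.
rewrite [in RHS](morita_right_dual_basis p) big_map linear_sum /=.
by apply: eq_bigr => x _; rewrite linearZ (moritaPQP mc).
Qed.

End RightDualBasis.

Section LeftDualBasis.
Variable r : seq (Q * P).
Hypothesis sum_beta : \sum_(x <- r) beta x.1 x.2 = 1.

Lemma morita_left_dual_basis :
  dual_basis [seq (linear_of (pairing_linearl x.1 (morita_bilinearl mc)),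
                   x.2) | x <- r].
Proof.
move=> p; rewrite big_map /= -{1}[p](@rscale1 S R P) -sum_beta rscale_sumr.
by apply: eq_bigr => x _; rewrite (moritaPQP mc).
Qed.

Lemma morita_rmul_bijective : bijective (@rmul S R P).
Proof.
exists (fun h : EndRing P => \sum_(x <- r) beta x.1 (h x.2)) => [a|h].
  under eq_bigr do rewrite /= /rmul_fun (pairingZr (morita_bilinearr mc)).
  by rewrite -mulr_suml sum_beta mul1r.
apply: linear_ext => p; rewrite /= /rmul_fun rscale_sumr.
rewrite [in RHS](morita_left_dual_basis p) big_map linear_sum /=.
by apply: eq_bigr => x _; rewrite linearZ -(moritaPQP mc).
Qed.

End LeftDualBasis.

Lemma morita_rank_one :
  onto_pairing alpha -> onto_pairing beta -> projective_rank_one P.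
Proof.
move=> [r sum_alpha] [r' sum_beta]; split.
- split; [exact: morita_lmul_bijective sum_alpha|].
  exact: morita_rmul_bijective sum_beta.
- have dbP := morita_right_dual_basis sum_alpha.
  split; [exact: dual_basis_finitely_generated dbP|].
  exact: dual_basis_projective dbP.
have dbP := morita_left_dual_basis sum_beta.
split; [exact: dual_basis_finitely_generated dbP|].
exact: dual_basis_projective dbP.
Qed.

End RankOne.

Section LeftDual.
Variables (S R : pzRingType) (P : bimodType S R).

Definition left_dual : Type := {linear P -> S^o}.
Local Notation Q := left_dual.
Implicit Types f g h : Q.

HB.instance Definition _ := gen_eqMixin Q.
HB.instance Definition _ := gen_choiceMixin Q.

Definition dual_eval (p : P) (f : Q) : S := (f : {linear P -> S^o}) p.

Lemma left_dual_ext f g : dual_eval^~ f =1 dual_eval^~ g -> f = g.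
Proof. exact: (@linear_ext S P S^o f g). Qed.

Definition dual0 : Q := \0 : {linear P -> S^o}.
Definition dualN f : Q := (\- (f : {linear P -> S^o})) : {linear P -> S^o}.
Definition dualD f g : Q :=
  ((f : {linear P -> S^o}) \+ (g : {linear P -> S^o})) : {linear P -> S^o}.
Definition dual_scale (a : R) f : Q :=
  ((f : {linear P -> S^o}) \o rmul_fun a) : {linear P -> S^o}.

Lemma dual_rscale_linear f (s : S) : linear (fun p => dual_eval p f * s : S^o).
Proof.
by move=> t p q; rewrite /dual_eval linearP mulrDl -[_ *: _]/(_ * _) -mulrA.
Qed.
Definition dual_rscale f (s : S) : Q := linear_of (dual_rscale_linear f s).

Lemma dualDA : associative dualD.
Proof. by move=> f g h; apply: left_dual_ext => p; apply: addrA. Qed.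
Lemma dualDC : commutative dualD.
Proof. by move=> f g; apply: left_dual_ext => p; apply: addrC. Qed.
Lemma dual0D : left_id dual0 dualD.
Proof. by move=> f; apply: left_dual_ext => p; apply: add0r. Qed.
Lemma dualND : left_inverse dual0 dualN dualD.
Proof. by move=> f; apply: left_dual_ext => p; apply: addNr. Qed.
HB.instance Definition _ := GRing.isZmodule.Build Q dualDA dualDC dual0D dualND.

Lemma dual_scaleA a b f : dual_scale a (dual_scale b f) = dual_scale (a * b) f.
Proof. by apply: linear_ext => p; rewrite /= /rmul_fun rscaleA. Qed.
Lemma dual_scale1 : left_id 1 dual_scale.
Proof. by move=> f; apply: linear_ext => p; rewrite /= /rmul_fun rscale1. Qed.
Lemma dual_scaleDr : right_distributive dual_scale +%R.
Proof. by move=> a f g; apply: linear_ext. Qed.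
Lemma dual_scaleDl f : {morph dual_scale^~ f : a b / a + b}.
Proof.
by move=> a b; apply: linear_ext => p; rewrite /= /rmul_fun rscaleDr linearD.
Qed.
HB.instance Definition _ := GRing.Zmodule_isLmodule.Build R Q
  dual_scaleA dual_scale1 dual_scaleDr dual_scaleDl.

Lemma dual_rscaleA f s t :
  dual_rscale (dual_rscale f s) t = dual_rscale f (s * t).
Proof. by apply: left_dual_ext => p; apply/esym/mulrA. Qed.
Lemma dual_rscale1 f : dual_rscale f 1 = f.
Proof. by apply: left_dual_ext => p; apply: mulr1. Qed.
Lemma dual_rscaleDl s : {morph dual_rscale^~ s : f g / f + g}.
Proof. by move=> f g; apply: left_dual_ext => p; apply: mulrDl. Qed.
Lemma dual_rscaleDr f : {morph dual_rscale f : s t / s + t}.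
Proof. by move=> s t; apply: left_dual_ext => p; apply: mulrDr. Qed.
Lemma dual_scale_rscale (a : R) f s :
  a *: dual_rscale f s = dual_rscale (a *: f) s.
Proof. exact: left_dual_ext. Qed.
HB.instance Definition _ := isBimodule.Build R S Q
  dual_rscaleA dual_rscale1 dual_rscaleDl dual_rscaleDr dual_scale_rscale.

Lemma dual_eval_bilinear : bilinear_pairing (dual_eval : P -> Q -> S).
Proof.
split=> [|s p f|s p f] //; last exact: (linearZ_LR (f : {linear P -> S^o})).
by split=> // f p q; apply: (linearD (f : {linear P -> S^o})).
Qed.

End LeftDual.

Section DualContext.
Variables (S R : pzRingType) (P : bimodType S R).
Local Notation PR := (right_module P : lmodType R^c).
Local Notation Q := (left_dual P).

Lemma rmul_inj_ext (a b : R) :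
  injective (@rmul S R P) -> (forall p : P, p *r a = p *r b) -> a = b.
Proof. by move=> inj ab; apply: inj; apply: linear_ext. Qed.

Lemma lmul_inj_ext (s t : S) :
  injective (@lmul S R P) -> (forall p : P, s *: p = t *: p) -> s = t.
Proof. by move=> inj st; apply: inj; apply: linear_ext. Qed.

Lemma rmul_bijective_linear (h : {linear P -> P}) :
  bijective (@rmul S R P) -> exists a : R, forall p, h p = p *r a.
Proof.
case=> g _ gK; exists (g (h : EndRing P)) => p.
exact: (esym (congr1 (fun k : EndRing P => k p) (gK h))).
Qed.

Lemma lmul_bijective_linear (h : {linear PR -> PR}) :
  bijective (@lmul S R P) -> exists s : S, forall p : P, h p = s *: p.
Proof.
case=> g _ gK; exists (g (h : EndRing PR)) => p.
exact: (esym (congr1 (fun k : EndRing PR => k p) (gK h))).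
Qed.

Lemma rmul_bijective_morita : bijective (@rmul S R P) ->
  exists beta : Q -> P -> R, morita_context (@dual_eval S R P) beta.
Proof.
move=> rmul_bij.
have ext a b := @rmul_inj_ext a b (bij_inj rmul_bij).
have /choice[beta betaE] (fq : Q * P) :
    exists a : R, forall p, dual_eval p fq.1 *: fq.2 = p *r a.
  have scale_linear : linear (fun p => dual_eval p fq.1 *: fq.2).
    by move=> s p p'; rewrite /dual_eval linearP scalerDl scalerA.
  exact: rmul_bijective_linear (linear_of scale_linear) rmul_bij.
exists (fun f q => beta (f, q)).
have betaP f p q : p *r beta (f, q) = dual_eval p f *: q by rewrite -betaE.
split=> [|||f p g].
- exact: dual_eval_bilinear.
- split=> [|a f q|a f q].
  + split=> [q f g|f q q'|f s q]; apply: ext => p.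
    * by rewrite rscaleDr !betaP -scalerDl.
    * by rewrite rscaleDr !betaP scalerDr.
    * by rewrite !betaP scalerA.
  + by apply: ext => p; rewrite -rscaleA !betaP.
  + by apply: ext => p; rewrite -rscaleA !betaP scale_rscale.
- by move=> p f q; rewrite betaP.
apply: left_dual_ext => p'; rewrite -[LHS]/(dual_eval (_ *r _) g) betaP.
exact: (pairingZl (dual_eval_bilinear P)).
Qed.

Lemma essentially_surjective_onto_eval :
  essentially_surjective (tensor_functor P) -> onto_pairing (@dual_eval S R P).
Proof.
case/(_ (S^o : lmodType S)) => M [f [g [_ fg]]].
have [r def_g1] := tensor_sum (g 1).
exists [seq (x.1, (f \o linear_of (@tens_linearl S R P M x.2)) : Q) | x <- r].
rewrite big_map; have /= <- := congr1 (fun h : {linear S^o -> S^o} => h 1) fg.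
by rewrite def_g1 linear_sum.
Qed.

Lemma lmul_bijective_dual (phi : {linear PR -> (R^c)^o}) :
  bijective (@lmul S R P) ->
  exists f : Q, forall p q, dual_eval p f *: q = p *r phi q.
Proof.
move=> lmul_bij; have ext s t := @lmul_inj_ext s t (bij_inj lmul_bij).
have /choice[f fE] (p : P) : exists s : S, forall q : P, p *r phi q = s *: q.
  have act_linear : linear (fun q : PR => p *r phi q : PR).
    move=> a q q'; rewrite linearP [LHS](rscaleDr p); congr (_ + _).
    exact/esym/rscaleA.
  exact: lmul_bijective_linear (linear_of act_linear) lmul_bij.
have f_linear : linear (f : P -> S^o).
  move=> s p p'; apply: ext => q.
  by rewrite -fE rscaleDl -scale_rscale !fE scalerA -scalerDl.
by exists (linear_of f_linear) => p q; rewrite fE.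
Qed.

Lemma projective_onto_eval :
  bijective (@lmul S R P) -> finitely_generated PR -> projective PR ->
  onto_pairing (@dual_eval S R P).
Proof.
move=> lmul_bij fgP projP.
have [r dbP] := projective_dual_basis fgP projP.
have /choice[d dE] phi := lmul_bijective_dual phi lmul_bij.
exists [seq (x.2 : P, d x.1) | x <- r]; rewrite big_map.
apply: lmul_inj_ext (bij_inj lmul_bij) _ => p.
rewrite scale1r scaler_suml [RHS](dbP (p : PR)).
by apply: eq_bigr => x _; rewrite dE.
Qed.

Lemma projective_onto_dual_pairing (beta : Q -> P -> R) :
  morita_context (@dual_eval S R P) beta -> bijective (@rmul S R P) ->
  finitely_generated P -> projective P -> onto_pairing beta.
Proof.
move=> mc rmul_bij fgP projP; have [r dbP] := projective_dual_basis fgP projP.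
exists r; apply: rmul_inj_ext (bij_inj rmul_bij) _ => p.
rewrite rscale1 [RHS]dbP rscale_sumr.
by apply: eq_bigr => x _; rewrite -(moritaPQP mc).
Qed.

End DualContext.

Theorem theorem4p9 (R S : pzRingType) (P : bimodType S R) :
  invertible P <-> projective_rank_one P.
Proof.
split=> [equivP|[[lmul_bij rmul_bij] [fgPR projPR] [fgP projP]]].
  have fullP := equivalence_full equivP.
  have faithP := equivalence_faithful equivP.
  have rmul_bij := full_faithful_rmul_bijective fullP faithP.
  have [beta mc] := rmul_bijective_morita rmul_bij.
  have onto_eval : onto_pairing (@dual_eval S R P).
    exact/essentially_surjective_onto_eval/equivalence_essentially_surjective.
  have onto_beta := full_faithful_onto_pairing mc fullP faithP onto_eval.
  exact: morita_rank_one mc onto_eval onto_beta.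
have [beta mc] := rmul_bijective_morita rmul_bij.
have onto_eval := projective_onto_eval lmul_bij fgPR projPR.
have onto_beta := projective_onto_dual_pairing mc rmul_bij fgP projP.
exact: morita_invertible mc onto_eval onto_beta.
Qed.
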